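(* Let $B=(b_{i_1\cdots i_m})_{1\le i_1,\dots,i_m\le mn}$ be any hypermatrix with noncommutative entries commuting with those of the $(p,u)$-matrix $T=(t_{ij})_{1\le i,j\le mn}$. For $I=\{i_1<\cdots<i_m\}\subset[1,mn]$ let $$c_I=\sum_{J}{\det}_q(T^J_I)\,b_J,$$ where $J$ runs over the subsets $\{j_1<\cdots<j_m\}$ of $[1,mn]$ and $b_J=b_{j_1\cdots j_m}$, and let $C$ be the hypermatrix with entries $c_{i_1\cdots i_m}=c_I$. Then $$\mathrm{Pf}_q(C)={\det}_q(T)\,\mathrm{Pf}_q(B).$$
   Context: Parameters: $u$, $p_{ij}$, $q_{ij}$ ($1\le i<j\le mn$) are complex numbers with $p_{ij}q_{ij}=u^2$ for $i<j$, $u^2\neq-1$. All entries lie in a unital associative $\mathbb C$-algebra. A $(p,u)$-matrix $T=(t_{ij})_{1\le i,j\le mn}$ is a matrix whose entries satisfy the defining relations of $\mathrm{M}_{p,u}(mn)$: for $i<j$, $k<l$ (first relation for all $i$, second for all $k$), $t_{ik}t_{il}=q_{kl}t_{il}t_{ik}$; $t_{ik}t_{jk}=p_{ij}t_{jk}t_{ik}$; $q_{kl}t_{il}t_{jk}=p_{ij}t_{jk}t_{il}$; $q_{kl}^{-1}t_{ik}t_{jl}-q_{ij}^{-1}t_{jl}t_{ik}=(1-u^{-2})t_{il}t_{jk}$. For a permutation $\sigma$ (or bijective sequence of indices) put $(-q)_\sigma=(-1)^{l(\sigma)}\prod_{i<j,\ \sigma_i>\sigma_j}q_{\sigma_j\sigma_i}$,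 $l(\sigma)$ being the number of inversions. ${\det}_q(T)=\sum_{\sigma\in S_{mn}}(-q)_\sigma t_{1,\sigma_1}\cdots t_{mn,\sigma_{mn}}$. For $J=\{j_1<\dots<j_m\}$, $I=\{i_1<\dots<i_m\}$, $T^J_I$ is the submatrix with rows $J$ and columns $I$, and ${\det}_q(T^J_I)=\sum_{\sigma}(-q)_{\sigma}t_{j_1\sigma_1}\cdots t_{j_m\sigma_m}$, the sum over all arrangements $\sigma=(\sigma_1,\dots,\sigma_m)$ of the elements of $I$. The multiparameter quantum hyper-Pfaffian of a hypermatrix $B$ with entries $b_{i_1\cdots i_m}$, $1\le i_k\le mn$, is $$\mathrm{Pf}_q(B)=\sum_{\sigma\in\Pi}(-q)_\sigma b_{\sigma(1)\cdots\sigma(m)}\cdots b_{\sigma(m(n-1)+1)\cdots\sigma(mn)},$$ where $\Pi$ is the set of $\sigma\in S_{mn}$ with $\sigma((k-1)m+1)<\sigma((k-1)m+2)<\cdots<\sigma(km)$ for $k=1,\dots,n$. Only entries with increasing indices occur in it. *)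

(* Defs.v *)
From HB Require Import structures.
From mathcomp Require Import all_boot all_order all_algebra.
From mathcomp Require Import perm complex reals.

Set Implicit Arguments.
Unset Strict Implicit.
Unset Printing Implicit Defensive.

Import Order.TTheory GRing.Theory Num.Theory.

Local Open Scope ring_scope.

(* Indices are 0-based: 'I_N stands for [1, N].  The parameter families p, q
   are total functions, but only the values p i j, q i j with i < j are used. *)

Definition increasing (k N : nat) (s : 'I_k -> 'I_N) : bool :=
  [forall i : 'I_k, forall j : 'I_k, (i < j)%N ==> (s i < s j)%N].

Definition inversion (k N : nat) (s : 'I_k -> 'I_N) (ij : 'I_k * 'I_k) : bool :=
  (ij.1 < ij.2)%N && (s ij.2 < s ij.1)%N.

(* (-q)_s, for a sequence s of pairwise distinct indices *)
Definition qsign (F : fieldType) (k N : nat) (q : 'I_N -> 'I_N -> F)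
    (s : 'I_k -> 'I_N) : F :=
  (-1) ^+ #|[set ij | inversion s ij]| *
  \prod_(ij | inversion s ij) q (s ij.2) (s ij.1).

Definition is_pu_matrix (F : fieldType) (A : algType F) (N : nat)
    (p q : 'I_N -> 'I_N -> F) (u : F) (T : 'M[A]_N) : Prop :=
  [/\ forall i k l : 'I_N, (k < l)%N ->
        T i k * T i l = q k l *: (T i l * T i k),
      forall i j k : 'I_N, (i < j)%N ->
        T i k * T j k = p i j *: (T j k * T i k),
      forall i j k l : 'I_N, (i < j)%N -> (k < l)%N ->
        q k l *: (T i l * T j k) = p i j *: (T j k * T i l)
    & forall i j k l : 'I_N, (i < j)%N -> (k < l)%N ->
        (q k l)^-1 *: (T i k * T j l) - (q i j)^-1 *: (T j l * T i k)
        = (1 - u ^- 2) *: (T i l * T j k)].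

Definition qdet (F : fieldType) (A : algType F) (N : nat)
    (q : 'I_N -> 'I_N -> F) (T : 'M[A]_N) : A :=
  \sum_(s : 'S_N) qsign q s *: \prod_(i < N) T i (s i).

(* det_q(T^J_I): rows J, columns I; s runs over the arrangements of I *)
Definition qminor (F : fieldType) (A : algType F) (N m : nat)
    (q : 'I_N -> 'I_N -> F) (T : 'M[A]_N) (J I : m.-tuple 'I_N) : A :=
  \sum_(s : m.-tuple 'I_N | perm_eq s I)
     qsign q (tnth s) *: \prod_(k < m) T (tnth J k) (tnth s k).

Lemma block_pos_subproof (m n : nat) (k : 'I_n) (r : 'I_m) :
  (k * m + r < m * n)%N.
Proof.
apply: (@leq_trans (k.+1 * m)).
  by rewrite mulSn addnC ltn_add2r.
by rewrite mulnC leq_mul2l ltn_ord orbT.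
Qed.

(* position r of block k among m * n positions cut into n blocks of length m *)
Definition block_pos (m n : nat) (k : 'I_n) (r : 'I_m) : 'I_(m * n) :=
  Ordinal (block_pos_subproof k r).

Definition block_increasing (m n : nat) (s : 'S_(m * n)) : bool :=
  [forall k : 'I_n, increasing (fun r : 'I_m => s (block_pos k r))].

Definition hypermatrix (m N : nat) (A : Type) : Type := m.-tuple 'I_N -> A.

Definition qhyperpf (F : fieldType) (A : algType F) (m n : nat)
    (q : 'I_(m * n) -> 'I_(m * n) -> F) (B : hypermatrix m (m * n) A) : A :=
  \sum_(s : 'S_(m * n) | block_increasing s)
     qsign q s *: \prod_(k < n) B [tuple s (block_pos k r) | r < m].

(* Main.v *)
Require Import Defs.
From HB Require Import structures.
From mathcomp Require Import all_boot all_order all_algebra.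
From mathcomp Require Import fingroup perm complex reals zify ring.

Set Implicit Arguments.
Unset Strict Implicit.
Unset Printing Implicit Defensive.

Import Order.TTheory GRing.Theory Num.Theory.

Local Open Scope ring_scope.

(* For any map f of the row indices let D(f) be the quantum determinant of the
   matrix whose rows are the rows f(1), f(2), ... of T.  Pairing sigma with
   (r r+1) sigma reduces D(f) to 2 x 2 minors of rows f(r), f(r+1); the defining
   relations say that such a minor vanishes for equal rows and is multiplied by
   -q when the rows are interchanged.  Sorting f by adjacent transpositions
   gives D(f) = (-q)_f det_q(T) if f is injective, and 0 otherwise.
   On the other hand (-q)_sigma factors as (-q) of the blockwise sorted sigma
   times the signs of the blocks, which yields a Laplace expansion of D(f)
   along the blocks J_1, ..., J_n of f.  Expanding Pf_q(C) and collecting the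
   coefficient of b_{J_1} ... b_{J_n} produces exactly D(J_1 ... J_n). *)

(** * The sign $(-q)_s$ under an adjacent transposition *)

Lemma qsignE (F : fieldType) (k N : nat) (q : 'I_N -> 'I_N -> F)
    (s : 'I_k -> 'I_N) :
  qsign q s = \prod_(ij | inversion s ij) - q (s ij.2) (s ij.1).
Proof.
rewrite prodrN /qsign; congr (_ ^+ _ * _).
by apply: eq_card => ij; rewrite inE.
Qed.

Lemma qsign_pairE (F : fieldType) (k N : nat) (q : 'I_N -> 'I_N -> F)
    (s : 'I_k -> 'I_N) :
  qsign q s = \prod_(i < k) \prod_(j < k)
    (if (i < j)%N && (s j < s i)%N then - q (s j) (s i) else 1).
Proof.
by rewrite qsignE big_mkcond /= pair_big; apply: eq_bigr => -[i j] _.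
Qed.

Lemma eq_qsign (F : fieldType) (k N : nat) (q : 'I_N -> 'I_N -> F)
    (s t : 'I_k -> 'I_N) : s =1 t -> qsign q s = qsign q t.
Proof.
move=> st; rewrite !qsign_pairE; apply: eq_bigr => i _; apply: eq_bigr => j _.
by rewrite !st.
Qed.

(** Since [a] and [b] are adjacent positions, [tperm a b] preserves the order of every pair of
    positions except [(a, b)]. It thus matches the inversions of [s] with those of the composite
    other than [(a, b)], which is the one new inversion. *)
Lemma qsign_tperm (F : fieldType) (k N : nat) (q : 'I_N -> 'I_N -> F)
    (s : 'I_k -> 'I_N) (a b : 'I_k) :
  b = a.+1 :> nat -> (s a < s b)%N ->
  qsign q (s \o tperm a b) = - q (s a) (s b) * qsign q s.
Proof.
move=> ba sab; rewrite !qsignE (bigD1 (a, b)) /=; last first.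
  by rewrite /inversion /= tpermL tpermR sab ba ltnSn.
rewrite tpermL tpermR; congr (_ * _).
pose h (ij : 'I_k * 'I_k) := (tperm a b ij.1, tperm a b ij.2).
have hK : involutive h by case=> i j; rewrite /h /= !tpermK.
rewrite [RHS](reindex_inj (inv_inj hK)) /=; apply: eq_bigl => -[i j].
rewrite /inversion /= xpair_eqE -!val_eqE /=.
case: (tpermP a b i) => [->|->|/val_eqP /= ia /val_eqP /= ib];
  case: (tpermP a b j) => [->|->|/val_eqP /= ja /val_eqP /= jb]; lia.
Qed.

(** * Quantum determinants of matrices with repeated or permuted rows *)

Lemma index_enum_adjacent (N : nat) (a b : 'I_N) : b = a.+1 :> nat ->
  exists l1 l2, index_enum 'I_N = l1 ++ [:: a, b & l2].
Proof.
move=> ba; have eE : index_enum 'I_N = enum 'I_N.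
  by rewrite enumT /index_enum; case: index_enum_key.
exists (take a (enum 'I_N)), (drop b.+1 (enum 'I_N)).
rewrite eE -[LHS](cat_take_drop a); congr (_ ++ _).
rewrite (drop_nth a) ?size_enum_ord // nth_ord_enum -ba.
by rewrite (drop_nth a) ?size_enum_ord // nth_ord_enum.
Qed.

(** [M] is the 2 x 2 quantum minor of two rows. The lemma serves twice: with [g = f] and [c = 0] for
    equal rows, and with [c = - q (g a) (g b)] for an interchange of rows. *)
Lemma qdet_rowsub_adjacent (F : fieldType) (A : algType F) (N : nat)
    (q : 'I_N -> 'I_N -> F) (T : 'M[A]_N) (f g : 'I_N -> 'I_N)
    (a b : 'I_N) (c : F) (M := fun i j k l : 'I_N =>
        T i k * T j l - q k l *: (T i l * T j k)) :
  b = a.+1 :> nat ->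
  (forall i, i != a -> i != b -> f i = g i) ->
  (forall k l : 'I_N, (k < l)%N ->
     M (f a) (f b) k l = c *: M (g a) (g b) k l) ->
  qdet q (rowsub f T) = c *: qdet q (rowsub g T).
Proof.
move=> ba fg fgM; have [l1 [l2 eE]] := index_enum_adjacent ba.
have ab : a != b by rewrite -val_eqE /= ba; lia.
have : uniq (l1 ++ [:: a, b & l2]) by rewrite -eE index_enum_uniq.
rewrite (uniq_catCA l1 [:: a; b] l2) /= inE !mem_cat !negb_or.
move=> /and3P[/and3P[_ a1 a2] /andP[b1 b2] _].
(* The product is ordered and [A] noncommutative; adjacency of [a] and [b] lets their two factors be
   isolated side by side. *)
have prodE (h : 'I_N -> 'I_N) (s : 'S_N) :
    \prod_(i < N) rowsub h T i (s i) =
    \prod_(i <- l1) T (h i) (s i) * (T (h a) (s a) * T (h b) (s b)) *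
    \prod_(i <- l2) T (h i) (s i).
  rewrite eE big_cat !big_cons /= !mxE !mulrA.
  by congr (_ * _ * _ * _); apply: eq_bigr => i _; rewrite mxE.
pose t := tperm a b.
have ts (s : 'S_N) : ((t * s)%g a = s b) * ((t * s)%g b = s a).
  by rewrite !permM tpermL tpermR.
have tfix (s : 'S_N) i : i != a -> i != b -> (t * s)%g i = s i.
  by move=> ia ib; rewrite permM tpermD // eq_sym.
have qdetE (h : 'I_N -> 'I_N) : qdet q (rowsub h T) =
    \sum_(s : 'S_N | (s a < s b)%N) qsign q s *:
      (\prod_(i <- l1) T (h i) (s i) * M (h a) (h b) (s a) (s b) *
       \prod_(i <- l2) T (h i) (s i)).
  rewrite /qdet (bigID (fun s : 'S_N => (s a < s b)%N)) /=.
  have tK : involutive (fun s : 'S_N => (t * s)%g).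
    by move=> s; rewrite mulgA tperm2 mul1g.
  (* Each [s] with [s b < s a] is replaced by its partner [t * s], so that both halves run over
     [s a < s b]. *)
  rewrite [X in _ + X](reindex_inj (inv_inj tK)) /=.
  rewrite [X in _ + X](eq_bigl (fun s : 'S_N => (s a < s b)%N)); last first.
    move=> s; rewrite !ts; move/eqP: ab; have := @perm_inj _ s a b.
    case: (ltngtP (s a) (s b)) => // /val_inj e /(_ e) -> //.
  rewrite -big_split; apply: eq_bigr => s sab /=; rewrite !prodE !ts.
  have -> : qsign q (t * s)%g = - q (s a) (s b) * qsign q s.
    by rewrite -qsign_tperm //; apply: eq_qsign => i /=; rewrite permM.
  have e l : a \notin l -> b \notin l ->
      \prod_(i <- l) T (h i) ((t * s)%g i) = \prod_(i <- l) T (h i) (s i).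
    move=> al bl; apply: eq_big_seq => i il; rewrite tfix //.
      by apply: contraNneq al => <-.
    by apply: contraNneq bl => <-.
  rewrite !e // mulNr scaleNr [q _ _ * _]mulrC -(scalerA (qsign q s)).
  by rewrite -scalerN -scalerDr /M mulrBr mulrBl -scalerAr -scalerAl.
rewrite !qdetE scaler_sumr; apply: eq_bigr => s sab.
rewrite fgM // -scalerAr -scalerAl !scalerA [_ * c]mulrC.
have e l : a \notin l -> b \notin l ->
    \prod_(i <- l) T (f i) (s i) = \prod_(i <- l) T (g i) (s i).
  move=> al bl; apply: eq_big_seq => i il; rewrite fg //.
    by apply: contraNneq al => <-.
  by apply: contraNneq bl => <-.
by rewrite !e.
Qed.

(** Values grow at least as fast as indices. From the first index to [i] this gives [i <= f i], from
    [i] to the last it gives [f i <= i]. *)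
Lemma adjacent_ltn_id (N : nat) (f : 'I_N -> 'I_N) :
  (forall a b : 'I_N, b = a.+1 :> nat -> (f a < f b)%N) -> f =1 id.
Proof.
case: N f => [|N] f lt_f i; first by case: i.
have H d : forall i j : 'I_N.+1, j = (i + d)%N :> nat -> (f i + d <= f j)%N.
  elim: d => [|d IH] k j jk.
    by rewrite addn0 (_ : k = j) //; apply: val_inj; rewrite /= jk addn0.
  have lt_kd : (k + d < N.+1)%N by have := ltn_ord j; rewrite jk; lia.
  have /lt_f : j = (Ordinal lt_kd).+1 :> nat by rewrite jk addnS.
  by have := IH k (Ordinal lt_kd) erefl; lia.
apply: val_inj => /=; have := H i ord0 i; have := H (N - i)%N i ord_max.
by have := ltn_ord (f ord_max); have := ltn_ord i; rewrite /=; lia.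
Qed.

Lemma qdet_rowsub (F : fieldType) (A : algType F) (N : nat) (u : F)
    (p q : 'I_N -> 'I_N -> F) (T : 'M[A]_N) (f : 'I_N -> 'I_N) :
  u != 0 -> (forall i j : 'I_N, (i < j)%N -> p i j * q i j = u ^+ 2) ->
  is_pu_matrix p q u T ->
  qdet q (rowsub f T) = if injectiveb f then qsign q f *: qdet q T else 0.
Proof.
move=> u0 hpq [rel1 rel2 rel3 rel4].
(* An inversion-type measure: it drops when an adjacent descent is removed. *)
pose W (f : 'I_N -> 'I_N) := (\sum_(i < N) (N - i) * f i)%N.
have q0 (i j : 'I_N) : (i < j)%N -> q i j != 0.
  move=> /hpq e; apply: contraNneq u0 => q0; move/eqP: e.
  by rewrite q0 mulr0 eq_sym expf_eq0 /=.
have p0 (i j : 'I_N) : (i < j)%N -> p i j != 0.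
  move=> /hpq e; apply: contraNneq u0 => p0; move/eqP: e.
  by rewrite p0 mul0r eq_sym expf_eq0 /=.
have [k] := ubnP (W f); elim: k f => // k IH f; rewrite ltnS => Wf.
case: (pickP (fun ab : 'I_N * 'I_N =>
    (ab.2 == ab.1.+1 :> nat) && (f ab.2 <= f ab.1)%N)) => [[a b]|noab] /=.
  move=> /andP[/eqP ba]; have ab : a != b by rewrite -val_eqE /= ba; lia.
  rewrite leq_eqVlt => /predU1P[/val_inj fba|fba].
    rewrite ifN; last first.
      by apply/injectiveP => /(_ _ _ fba)/eqP; rewrite eq_sym (negPf ab).
    rewrite (@qdet_rowsub_adjacent _ _ _ q T f f a b 0) ?scale0r // => i j ij.
    by rewrite scale0r fba rel1 // subrr.
  pose t := tperm a b; pose g := f \o t.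
  have fE : f =1 g \o t by move=> i; rewrite /g /= tpermK.
  have gab : (g a < g b)%N by rewrite /g /= tpermL tpermR.
  have injfg : injectiveb f = injectiveb g.
    apply/injectiveP/injectiveP => inj.
      by apply: inj_comp => //; apply: perm_inj.
    by move=> x y; rewrite !fE => /inj /perm_inj.
  have Wg : (W g < W f)%N.
    (* The weights [N - a] and [N - b] differ by 1, so the interchange lowers [W] by exactly
       [f a - f b]. *)
    rewrite /W [X in (X < _)%N](bigD1 a) // [X in (_ < X)%N](bigD1 a) //=.
    rewrite [X in (_ + X < _)%N](bigD1 b) 1?eq_sym //=.
    rewrite [X in (_ < _ + X)%N](bigD1 b) 1?eq_sym //=.
    rewrite /g /= tpermL tpermR.
    rewrite (eq_bigr (fun i : 'I_N => ((N - i) * f i)%N)) => [|i /andP[ia ib]].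
      by have := ltn_ord b; rewrite ba; nia.
    by rewrite tpermD // eq_sym.
  rewrite injfg (eq_qsign _ fE) qsign_tperm //.
  rewrite (@qdet_rowsub_adjacent _ _ _ q T f g a b (- q (g a) (g b))) //.
  - rewrite IH ?(leq_trans Wg) //.
    by case: ifP => _; rewrite ?scaler0 // scalerA.
  - by move=> i ia ib; rewrite /g /= tpermD // eq_sym.
  move=> i j ij; rewrite !fE /= tpermL tpermR.
  move: (g a) (g b) gab => r s rs {Wg fE injfg}.
  (* [e1] and [e2] move the factor from row [r] to the left. The coefficients of the two remaining
     monomials are then compared by means of $p_{rs}q_{rs}=u^2$. *)
  have e1 : T s i * T r j = (q i j / p r s) *: (T r j * T s i).
    by rewrite mulrC -scalerA rel3 // scalerA mulVf ?p0 // scale1r.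
  have e2 : T s j * T r i = (q r s / q i j) *: (T r i * T s j) -
      (q r s * (1 - u ^- 2)) *: (T r j * T s i).
    rewrite -!scalerA -rel4 // -scalerBr opprB addrC subrK scalerA.
    by rewrite mulfV ?q0 // scale1r.
  rewrite e1 e2 scalerBr !scalerA scalerBr scalerA.
  have -> : q i j * (q r s / q i j) = q r s by rewrite mulrC divfK ?q0.
  rewrite opprB addrA -scalerDl addrC mulNr !scaleNr opprK.
  congr (_ + _ *: _); rewrite -(hpq r s) //.
  by field; rewrite q0 ?p0.
have fid : f =1 id.
  apply: adjacent_ltn_id => a b ba.
  by have := noab (a, b); rewrite /= ba eqxx /= leqNgt => /negbFE.
have -> : injectiveb f by apply/injectiveP => x y; rewrite !fid.
have -> : qsign q f = 1.
  rewrite qsign_pairE big1 // => i _; rewrite big1 // => j _.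
  by rewrite !fid; case: ltngtP.
rewrite scale1r /qdet; apply: eq_bigr => s _; congr (_ *: _).
by apply: eq_bigr => i _; rewrite mxE fid.
Qed.

(** * Sequences of length $mn$ cut into $n$ blocks *)

Section Blocks.
Variables (m n : nat).

(** Positions are ordered lexicographically by block and offset, so the splitting keeps the order of
    factors and holds for a noncommutative [op]. *)
Lemma big_block (R : Type) (idx : R) (op : Monoid.law idx) (F : 'I_(m * n) -> R) :
  \big[op/idx]_(i < m * n) F i =
  \big[op/idx]_(k < n) \big[op/idx]_(r < m) F (block_pos k r).
Proof.
have splitE (G : nat -> R) : \big[op/idx]_(i < m * n) G i =
    \big[op/idx]_(k < n) \big[op/idx]_(r < m) G (k * m + r)%N.
  rewrite -(big_mkord xpredT) mulnC big_nat_mul big_mkord.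
  apply: eq_bigr => k _.
  rewrite -{1}[(k * m)%N]add0n big_addn mulSn addnK big_mkord.
  by apply: eq_bigr => r _; rewrite addnC.
(* [G] extends [F] to all naturals, with [idx] as default outside the range. *)
pose G x := oapp F idx (insub x).
rewrite (eq_bigr (fun i : 'I_(m * n) => G i)) => [|i _]; last by rewrite /G valK.
rewrite splitE; apply: eq_bigr => k _; apply: eq_bigr => r _.
by rewrite /G -[(k * m + r)%N]/(val (block_pos k r)) valK.
Qed.

Lemma block_of_subproof (i : 'I_(m * n)) : (i %/ m < n)%N.
Proof.
by case: m i => [|m'] i; [case: i | rewrite ltn_divLR // [(n * _)%N]mulnC].
Qed.

Lemma block_off_subproof (i : 'I_(m * n)) : (i %% m < m)%N.
Proof. by case: m i => [|m'] i; [case: i | rewrite ltn_mod]. Qed.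

Definition flat (T : Type) (t : {ffun 'I_n -> m.-tuple T}) (i : 'I_(m * n)) : T :=
  tnth (t (Ordinal (block_of_subproof i))) (Ordinal (block_off_subproof i)).

Definition blocks (T : Type) (f : 'I_(m * n) -> T) : {ffun 'I_n -> m.-tuple T} :=
  [ffun k => [tuple f (block_pos k r) | r < m]].

Lemma flat_block_pos (T : Type) (t : {ffun 'I_n -> m.-tuple T}) k r :
  flat t (block_pos k r) = tnth (t k) r.
Proof.
have m0 : (0 < m)%N by case: m r => // -[].
rewrite /flat; congr (tnth (t _) _); apply: val_inj => /=.
  by rewrite divnMDl // divn_small ?addn0.
by rewrite modnMDl modn_small.
Qed.

Lemma flatK (T : Type) : cancel (@flat T) (@blocks T).
Proof.
move=> t; apply/ffunP => k; rewrite ffunE; apply: eq_from_tnth => r.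
by rewrite tnth_mktuple flat_block_pos.
Qed.

Lemma blocksK (T : Type) (f : 'I_(m * n) -> T) : flat (blocks f) =1 f.
Proof.
move=> i; rewrite /flat ffunE tnth_mktuple; congr f; apply: val_inj => /=.
by rewrite -divn_eq.
Qed.

Lemma count_codom_flat (T : finType) (t : {ffun 'I_n -> m.-tuple T}) (P : pred T) :
  count P (codom (flat t)) = (\sum_(k < n) count P (t k))%N.
Proof.
rewrite -sum1_count codomE big_map big_enum_cond big_mkcond big_block.
apply: eq_bigr => k _; rewrite -sum1_count big_tuple [RHS]big_mkcond.
by apply: eq_bigr => r _; rewrite flat_block_pos.
Qed.

(** Injectivity depends only on the multiset of values, and rearranging inside blocks preserves all
    its counts. *)
Lemma injectiveb_flat_perm (T : finType) (t1 t2 : {ffun 'I_n -> m.-tuple T}) :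
  (forall k, perm_eq (t1 k) (t2 k)) -> injectiveb (flat t1) = injectiveb (flat t2).
Proof.
move=> t12; have codomP (f : 'I_(m * n) -> T) : injectiveb f = uniq (codom f).
  by rewrite codomE.
rewrite !codomP; apply/perm_uniq/seq.permP => P; rewrite !count_codom_flat.
by apply: eq_bigr => k _; apply/seq.permP.
Qed.

Lemma uniq_block (T : finType) (t : {ffun 'I_n -> m.-tuple T}) k :
  injectiveb (flat t) -> uniq (t k).
Proof.
move=> /injectiveP inj; apply/tuple_uniqP => r s rs.
have := inj (block_pos k r) (block_pos k s); rewrite !flat_block_pos => /(_ rs).
by move/(congr1 val) => /= /addnI /val_inj.
Qed.

(** Cutting into blocks is a bijection from permutations to families with injective concatenation.
    On families, unlike on permutations, a sum can be distributed block by block. *)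
Lemma sum_perm_blocks (V : nmodType) (P : pred {ffun 'I_n -> m.-tuple 'I_(m * n)})
    (G : {ffun 'I_n -> m.-tuple 'I_(m * n)} -> V) :
  \sum_(s : 'S_(m * n) | P (blocks s)) G (blocks s) =
  \sum_(t | injectiveb (flat t) && P t) G t.
Proof.
(* The identity is a default for non-injective families, which lie outside the sum. *)
pose perm_of_flat (t : {ffun 'I_n -> m.-tuple 'I_(m * n)}) : 'S_(m * n) :=
  if @injectiveP _ _ (flat t) is ReflectT inj then perm inj else 1%g.
have flatP t : injectiveb (flat t) -> perm_of_flat t =1 flat t.
  rewrite /perm_of_flat.
  by move/injectiveP => inj i; case: injectiveP => // inj'; rewrite permE.
have blocks_perm t : injectiveb (flat t) -> blocks (perm_of_flat t) = t.
  move=> inj; rewrite -[RHS]flatK; apply/ffunP => k; rewrite !ffunE.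
  by apply: eq_from_tnth => r; rewrite !tnth_mktuple flatP.
have injs (s : 'S_(m * n)) : injectiveb (flat (blocks s)).
  by apply/injectiveP => x y; rewrite !blocksK; apply: perm_inj.
rewrite [RHS](reindex_onto (fun s : 'S_(m * n) => blocks s) perm_of_flat) /=.
  apply: eq_bigl => s; rewrite injs /=.
  suff -> : perm_of_flat (blocks s) = s by rewrite eqxx andbT.
  by apply/permP => i; rewrite flatP // blocksK.
by move=> t /andP[/blocks_perm].
Qed.

(** Inversions lie inside one block or between two blocks [k < l]. The factor for the latter sees
    each block only as a multiset, whence the products over [x <- t k] and [y <- t l]. *)
Lemma qsign_flat (F : fieldType) (N : nat) (q : 'I_N -> 'I_N -> F)
    (t : {ffun 'I_n -> m.-tuple 'I_N}) :
  qsign q (flat t) = \prod_(k < n) qsign q (tnth (t k)) *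
    \prod_(k < n) \prod_(l < n | (k < l)%N)
      \prod_(x <- t k) \prod_(y <- t l | (y < x)%N) - q y x.
Proof.
rewrite qsign_pairE big_block -big_split; apply: eq_bigr => k _ /=.
under eq_bigr => r _ do rewrite big_block.
rewrite exchange_big /= (bigD1 k) //=; congr (_ * _).
  rewrite qsign_pairE; apply: eq_bigr => r _; apply: eq_bigr => r' _.
  by rewrite !flat_block_pos /= ltn_add2l.
rewrite big_mkcond [RHS]big_mkcond; apply: eq_bigr => l _.
rewrite big_tuple -val_eqE /=; case: ltngtP => //= kl.
- apply: eq_bigr => r _; rewrite big_tuple [RHS]big_mkcond.
  apply: eq_bigr => r' _; rewrite !flat_block_pos.
  have -> // : (k * m + r < l * m + r')%N by have := ltn_ord r; nia.
rewrite big1 // => r _; rewrite big1 // => r' _.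
rewrite ifN // negb_and -leqNgt; apply/orP; left.
by have := ltn_ord r'; nia.
Qed.

End Blocks.

(** * Blockwise sorting *)

Definition sort_ord (m N : nat) (t : m.-tuple 'I_N) : m.-tuple 'I_N :=
  sort_tuple <=%O t.

Lemma increasing_sorted (m N : nat) (t : m.-tuple 'I_N) :
  increasing (tnth t) = sorted <%O t.
Proof.
rewrite sorted_pairwise; last exact: lt_trans.
case: N t => [|N] t.
  case: m t => [|m] t; last by case: (tnth t ord0).
  by rewrite tuple0; apply/forallP => -[].
apply/'forall_'forall_implyP/(pairwiseP ord0) => [inc i j|inc i j ij].
  rewrite !inE size_tuple => im jm ij.
  by have := inc (Ordinal im) (Ordinal jm) ij; rewrite !(tnth_nth ord0).
by rewrite !(tnth_nth ord0); apply: inc; rewrite // inE size_tuple.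
Qed.

Lemma increasing_sort (m N : nat) (t : m.-tuple 'I_N) :
  uniq t -> increasing (tnth (sort_ord t)).
Proof. by rewrite increasing_sorted sort_lt_sorted. Qed.

(** Identifies the arrangements summed over in [qminor] with a fibre of sorting. *)
Lemma perm_eq_increasing (m N : nat) (s t : m.-tuple 'I_N) :
  increasing (tnth t) -> perm_eq s t = (sort_ord s == t).
Proof.
rewrite increasing_sorted lt_sorted_uniq_le => /andP[_ /sort_le_id t_id].
by rewrite -val_eqE /= -{2}t_id; apply/perm_sort_leP/eqP.
Qed.

Lemma qsign_increasing (F : fieldType) (k N : nat) (q : 'I_N -> 'I_N -> F)
    (s : 'I_k -> 'I_N) : increasing s -> qsign q s = 1.
Proof.
move=> /forallP inc; rewrite qsign_pairE big1 // => i _; rewrite big1 // => j _.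
case: ifP => // /andP[ij]; have /forallP/(_ j) := inc i.
by rewrite ij /=; case: ltngtP.
Qed.

Definition sort_blocks (m n N : nat) (t : {ffun 'I_n -> m.-tuple 'I_N}) :
    {ffun 'I_n -> m.-tuple 'I_N} := [ffun k => sort_ord (t k)].

Definition blocks_increasing (m n N : nat) (t : {ffun 'I_n -> m.-tuple 'I_N}) :=
  [forall k, increasing (tnth (t k))].

Lemma perm_sort_blocks (m n N : nat) (t : {ffun 'I_n -> m.-tuple 'I_N}) k :
  perm_eq (t k) (sort_blocks t k).
Proof. by rewrite ffunE perm_sym; apply/permPl/perm_sort. Qed.

(** Sorting preserves the cross-block factor of [qsign_flat]. Injectivity makes the sorted blocks
    strictly increasing, so their inner signs become 1. *)
Lemma qsign_sort_blocks (F : fieldType) (m n N : nat) (q : 'I_N -> 'I_N -> F)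
    (t : {ffun 'I_n -> m.-tuple 'I_N}) :
  injectiveb (flat t) ->
  qsign q (flat t) =
  qsign q (flat (sort_blocks t)) * \prod_(k < n) qsign q (tnth (t k)).
Proof.
move=> inj; rewrite !qsign_flat mulrC.
rewrite [X in _ = X * _ * _]big1 ?mul1r => [|k _]; last first.
  by rewrite ffunE qsign_increasing // increasing_sort // uniq_block.
congr (_ * _); apply: eq_bigr => k _; apply: eq_bigr => l _.
rewrite (perm_big _ (perm_sort_blocks t k)); apply: eq_bigr => x _.
by rewrite (perm_big _ (perm_sort_blocks t l)).
Qed.

(** * Laplace expansion and the product formula *)

Lemma qhyperpfE (F : fieldType) (A : algType F) (m n : nat)
    (q : 'I_(m * n) -> 'I_(m * n) -> F) (B : hypermatrix m (m * n) A) :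
  qhyperpf q B =
  \sum_(t | injectiveb (flat t) && blocks_increasing t)
     qsign q (flat t) *: \prod_(k < n) B (t k).
Proof.
rewrite -(sum_perm_blocks (@blocks_increasing m n (m * n))
  (fun t => qsign q (flat t) *: \prod_(k < n) B (t k))).
apply: eq_big => s.
  apply: eq_forallb => k; rewrite /increasing.
  by apply: eq_forallb => i; apply: eq_forallb => j; rewrite ffunE !tnth_mktuple.
move=> _; congr (_ *: _); first by apply: eq_qsign => i; rewrite blocksK.
by apply: eq_bigr => k _; rewrite ffunE.
Qed.

(** Terms are grouped by their sorted blocks [I]. The family [J] is arbitrary because expanding
    $\mathrm{Pf}_q(C)$ also produces overlapping row sets. *)
Lemma qdet_laplace_blocks (F : fieldType) (A : algType F) (m n : nat)
    (q : 'I_(m * n) -> 'I_(m * n) -> F) (T : 'M[A]_(m * n))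
    (J : {ffun 'I_n -> m.-tuple 'I_(m * n)}) :
  qdet q (rowsub (flat J) T) =
  \sum_(I | injectiveb (flat I) && blocks_increasing I)
     qsign q (flat I) *: \prod_(k < n) qminor q T (J k) (I k).
Proof.
pose G (t : {ffun 'I_n -> m.-tuple 'I_(m * n)}) :=
  \prod_(k < n) \prod_(r < m) T (tnth (J k) r) (tnth (t k) r).
transitivity (\sum_(t | injectiveb (flat t) && true) qsign q (flat t) *: G t).
  rewrite -(sum_perm_blocks xpredT (fun t => qsign q (flat t) *: G t)).
  apply: eq_bigr => s _; congr (_ *: _).
    by apply: eq_qsign => i; rewrite blocksK.
  rewrite big_block; apply: eq_bigr => k _; apply: eq_bigr => r _.
  by rewrite mxE flat_block_pos ffunE tnth_mktuple.
rewrite (partition_big (@sort_blocks m n _)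
  (fun I => injectiveb (flat I) && blocks_increasing I)) /=; last first.
  move=> t; rewrite andbT => inj.
  rewrite -(injectiveb_flat_perm (perm_sort_blocks t)) inj /=.
  by apply/forallP => k; rewrite ffunE increasing_sort // uniq_block.
apply: eq_bigr => I /andP[injI /forallP incI].
(* The product of minors expands over families of independent arrangements of the [I k], which is
   exactly the fibre of [sort_blocks] over [I]. *)
rewrite [in RHS]/qminor bigA_distr_big_dep scaler_sumr.
apply: eq_big => [t | t /andP[/andP[inj _] /eqP tI]]; last first.
  by rewrite scaler_prod scalerA qsign_sort_blocks // tI.
rewrite andbT; apply/andP/familyP => [[_ /eqP <-] k | tI].
  exact: perm_sort_blocks.
split; first by rewrite (injectiveb_flat_perm tI).
apply/eqP/ffunP => k; apply/eqP.
by rewrite ffunE -perm_eq_increasing //; apply: tI.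
Qed.

Theorem theorem6p3 (R : realType) (A : algType R[i]) (m n : nat)
    (u : R[i]) (p q : 'I_(m * n) -> 'I_(m * n) -> R[i])
    (T : 'M[A]_(m * n)) (B C : hypermatrix m (m * n) A)
    (hu0 : u != 0) (hu : u ^+ 2 != -1)
    (hpq : forall i j : 'I_(m * n), (i < j)%N -> p i j * q i j = u ^+ 2)
    (hT : is_pu_matrix p q u T)
    (hB : forall (i j : 'I_(m * n)) (J : m.-tuple 'I_(m * n)),
        B J * T i j = T i j * B J)
    (hC : forall I : m.-tuple 'I_(m * n), increasing (tnth I) ->
        C I = \sum_(J : m.-tuple 'I_(m * n) | increasing (tnth J))
                qminor q T J I * B J) :
  qhyperpf q C = qdet q T * qhyperpf q B.
Proof.
(* This lets all minors be collected to the left of all entries of [B]. *)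
have commB I J K : GRing.comm (qminor q T J I) (B K).
  apply/commr_sym/commr_sum => s _; rewrite /GRing.comm -scalerAl -scalerAr.
  by congr (_ *: _); apply: commr_prod => k _; apply: hB.
rewrite !qhyperpfE.
transitivity (\sum_(I : {ffun 'I_n -> m.-tuple 'I_(m * n)}
      | injectiveb (flat I) && blocks_increasing I)
    \sum_(J : {ffun 'I_n -> m.-tuple 'I_(m * n)} | blocks_increasing J)
      qsign q (flat I) *:
        (\prod_(k < n) qminor q T (J k) (I k) * \prod_(k < n) B (J k))).
  apply: eq_bigr => I /andP[_ /forallP incI]; rewrite -scaler_sumr.
  congr (_ *: _); rewrite (eq_bigr _ (fun k _ => hC _ (incI k))).
  rewrite bigA_distr_big_dep.
  apply: eq_big => [J | J _]; first exact/familyP/forallP.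
  by rewrite prodrM_comm.
(* Injectivity of [flat J] on the right becomes an [if], matching the one in [qdet_rowsub]:
   overlapping blocks [J] contribute 0. *)
rewrite exchange_big /= mulr_sumr [RHS]big_mkcondl /=.
apply: eq_bigr => J _.
under eq_bigr => I _ do rewrite scalerAl.
rewrite -mulr_suml -qdet_laplace_blocks (qdet_rowsub _ hu0 hpq hT).
by case: ifP => _; rewrite ?mul0r // -scalerAl -scalerAr.
Qed.
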